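(* Let $\vec r(t)=(x(t),y(t))$, $t_0<t<t_1$, be a simple curve of class $C^2$ in $\mathbb{R}^2$, and let $A=(a_1,a_2)\neq(0,0)$ be a point of $\mathbb{R}^2$ not lying on the curve. Let $P=P(t)=(x(t),y(t))$ be the moving point on the curve with parameter $t$. Then for every $t\in(t_0,t_1)$: (i) For $\mathcal{D}=|\overrightarrow{AP}|$, we have $$\frac{d\mathcal{D}}{dt}=\frac{(x(t)-a_1)x'(t)+(y(t)-a_2)y'(t)}{\sqrt{(x(t)-a_1)^2+(y(t)-a_2)^2}}.$$ (ii) The rotational speed of $\overrightarrow{AP}$ with respect to $t$ is $$\frac{|(x(t)-a_1)y'(t)-x'(t)(y(t)-a_2)|}{(x(t)-a_1)^2+(y(t)-a_2)^2}.$$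
   Context: For a nowhere-zero differentiable vector function $\vec w(t)$, write $\vec e_{\vec w}=\vec w/|\vec w|$. The rotational speed of $\vec w$ with respect to $t$ is $\left|\frac{d\vec e_{\vec w}}{dt}\right|$. *)

(* Defs.v *)
From Stdlib Require Import Reals.
From Coquelicot Require Import Coquelicot.
Open Scope R_scope.

(** Plane vectors are pairs of reals. Coquelicot's [norm] on this product is the
    Euclidean one, not the sup norm. *)
Lemma norm_plane (u : R * R) : norm u = sqrt (fst u ^ 2 + snd u ^ 2).
Proof.
  change (sqrt (Rabs (fst u) ^ 2 + Rabs (snd u) ^ 2)
          = sqrt (fst u ^ 2 + snd u ^ 2)).
  now rewrite !pow2_abs.
Qed.

(** [ex_derive_n f k t] only asserts that the [k-1]-st (total) derivative is
    differentiable at [t], hence the quantification over all orders up to [n]. *)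
Definition class_C (n : nat) (f : R -> R) (a b : R) : Prop :=
  forall (k : nat) (t : R), (k <= n)%nat -> a < t < b ->
    ex_derive_n f k t /\ continuous (Derive_n f k) t.

Definition curve (x y : R -> R) (t : R) : R * R := (x t, y t).

Definition simple_on (r : R -> R * R) (a b : R) : Prop :=
  forall s t : R, a < s < b -> a < t < b -> r s = r t -> s = t.

Definition vec (A P : R * R) : R * R := minus P A.

(** Meaningful only where [w] does not vanish, since [/ 0] is unspecified. *)
Definition direction (w : R -> R * R) (t : R) : R * R :=
  scal (/ norm (w t)) (w t).

(** Relational because Coquelicot's total [Derive] covers only real-valued
    functions. *)
Definition is_rotational_speed (w : R -> R * R) (t v : R) : Prop :=
  exists e' : R * R, is_derive (direction w) t e' /\ norm e' = v.

(* Main.v *)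
(** Write [(u, v)] for the vector from [A] to [P] and [d] for its length. Then
    [d' = (u u' + v v') / d], and the quotient rule gives
    [(u/d, v/d)' = ((u v' - u' v) / d^3) (-v, u)], a vector of length
    [|u v' - u' v| / d^2]. *)
Require Import Defs.
From Stdlib Require Import Reals Lra.
From Coquelicot Require Import Coquelicot.
Open Scope R_scope.

(** The pair is [f s] times [(1, 0)] plus [g s] times [(0, 1)], so the rules for sums and for scalar
    functions times a constant vector suffice. *)
Lemma is_derive_pair (f g : R -> R) (t l m : R) :
  is_derive f t l -> is_derive g t m ->
  is_derive (fun s => (f s, g s)) t (l, m).
Proof.
  intros hf hg.
  assert (split : forall a b : R,
    plus (scal a ((1, 0) : R * R)) (scal b ((0, 1) : R * R)) = (a, b)).
  { intros a b.
    change ((a * 1 + b * 0, a * 0 + b * 1) = (a, b)).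
    f_equal; ring. }
  rewrite <- split.
  apply (is_derive_ext
    (fun s => plus (scal (f s) ((1, 0) : R * R)) (scal (g s) ((0, 1) : R * R)))).
  - intros s; apply split.
  - set (V := prod_NormedModule R_AbsRing R_NormedModule R_NormedModule).
    exact (is_derive_plus (V := V) _ _ _ _ _
             (is_derive_scal_l (V := V) f t l (1, 0) hf)
             (is_derive_scal_l (V := V) g t m (0, 1) hg)).
Qed.

Lemma sum_squares_pos (p q : R) : (p, q) <> (0, 0) -> 0 < p ^ 2 + q ^ 2.
Proof.
  intros hpq.
  destruct (Req_dec p 0) as [-> | hp].
  - assert (hq : q <> 0) by now intros ->.
    assert (0 < q ^ 2) by now apply pow2_gt_0.
    lra.
  - assert (0 < p ^ 2) by now apply pow2_gt_0.
    assert (0 <= q ^ 2) by apply pow2_ge_0.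
    lra.
Qed.

Section PlaneVector.

Variables (u v : R -> R) (t du dv : R).
Hypotheses (hu : is_derive u t du) (hv : is_derive v t dv).
Hypothesis huv : (u t, v t) <> (0, 0).

(** Chain rule: [huv] keeps the radicand away from 0, where [sqrt] is not differentiable, and the 2
    from the squares cancels the 2 from the root. *)
Lemma is_derive_sqrt_sum_squares :
  is_derive (fun s => sqrt (u s ^ 2 + v s ^ 2)) t
    ((u t * du + v t * dv) / sqrt (u t ^ 2 + v t ^ 2)).
Proof.
  pose proof (sum_squares_pos _ _ huv) as hpos.
  assert (hd : 0 < sqrt (u t ^ 2 + v t ^ 2)) by now apply sqrt_lt_R0.
  assert (hsum : is_derive (fun s => u s ^ 2 + v s ^ 2) t
                   (2 * (u t * du + v t * dv))).
  { evar_last.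
    - apply @is_derive_plus; apply is_derive_pow; eassumption.
    - unfold plus; simpl; ring. }
  evar_last.
  - apply is_derive_sqrt; [exact hsum | exact hpos].
  - simpl in *; field; lra.
Qed.

Lemma is_derive_norm_plane :
  is_derive (fun s => norm ((u s, v s) : R * R)) t
    ((u t * du + v t * dv) / sqrt (u t ^ 2 + v t ^ 2)).
Proof.
  apply (is_derive_ext (fun s => sqrt (u s ^ 2 + v s ^ 2))).
  - intros s; symmetry; apply norm_plane.
  - exact is_derive_sqrt_sum_squares.
Qed.

Lemma is_rotational_speed_plane :
  is_rotational_speed (fun s => (u s, v s)) t
    (Rabs (u t * dv - du * v t) / (u t ^ 2 + v t ^ 2)).
Proof.
  pose proof (sum_squares_pos _ _ huv) as hpos.
  pose proof is_derive_norm_plane as hn.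
  set (d := sqrt (u t ^ 2 + v t ^ 2)) in *.
  assert (hd : 0 < d) by now apply sqrt_lt_R0.
  assert (hd2 : d ^ 2 = u t ^ 2 + v t ^ 2) by (apply pow2_sqrt; lra).
  assert (hnt : norm ((u t, v t) : R * R) = d) by apply norm_plane.
  (* The derivative of a unit vector is orthogonal to it, hence a multiple of [(- v t, u t)]. The
     factor [c] is the signed angular velocity divided by [d], the length of that vector. *)
  set (c := (u t * dv - du * v t) / d ^ 3).
  exists (- v t * c, u t * c); split.
  - assert (hinv : is_derive (fun s => / norm ((u s, v s) : R * R)) t
                     (- ((u t * du + v t * dv) / d) / d ^ 2)).
    (* Only the [d] in the denominator [d ^ 2] comes from the reciprocal rule; the first one belongs
       to the derivative of the norm. *)
    { rewrite <- hnt at 2.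
      apply is_derive_inv; [exact hn | rewrite hnt; lra]. }
    apply is_derive_pair.
    + evar_last.
      * apply (is_derive_mult _ _ _ _ _ hinv hu Rmult_comm).
      * rewrite hnt; unfold plus, mult, c; simpl.
        (* [field] does not know [hd2]. This form isolates [d ^ 2] in the numerator; once it is
           expanded, the terms in [u t ^ 2 * du] cancel and [- v t] factors out. *)
        transitivity ((d ^ 2 * du - u t * (u t * du + v t * dv)) / d ^ 3).
        -- field; lra.
        -- rewrite hd2; field; lra.
    + evar_last.
      * apply (is_derive_mult _ _ _ _ _ hinv hv Rmult_comm).
      * rewrite hnt; unfold plus, mult, c; simpl.
        transitivity ((d ^ 2 * dv - v t * (u t * du + v t * dv)) / d ^ 3).
        -- field; lra.
        -- rewrite hd2; field; lra.
  - rewrite norm_plane; simpl fst; simpl snd.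
    (* The vector [(- v t, u t)] has length [d], so the speed is the absolute value of [d * c]. *)
    replace ((- v t * c) ^ 2 + (u t * c) ^ 2) with ((d * c) ^ 2)
      by (rewrite Rpow_mult_distr, hd2; ring).
    rewrite <- Rsqr_pow2, sqrt_Rsqr_abs, <- hd2.
    replace (d * c) with ((u t * dv - du * v t) / d ^ 2)
      by (unfold c; field; lra).
    rewrite Rabs_div by (apply pow_nonzero; lra).
    now rewrite (Rabs_pos_eq (d ^ 2)) by apply pow2_ge_0.
Qed.

End PlaneVector.

Lemma class_C_is_derive (n : nat) (f : R -> R) (a b t : R) :
  (1 <= n)%nat -> class_C n f a b -> a < t < b -> is_derive f t (Derive f t).
Proof.
  intros hn hf ht.
  apply Derive_correct.
  (* At order 1, [ex_derive_n] unfolds to [ex_derive f t]. *)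
  exact (proj1 (hf 1%nat t hn ht)).
Qed.

Theorem proposition2p5 (x y : R -> R) (t0 t1 a1 a2 : R)
  (hx : class_C 2 x t0 t1) (hy : class_C 2 y t0 t1)
  (hsimple : simple_on (curve x y) t0 t1)
  (hA : (a1, a2) <> (0, 0))
  (hnot_on : forall t : R, t0 < t < t1 -> curve x y t <> (a1, a2)) :
  forall t : R, t0 < t < t1 ->
    is_derive (fun s : R => norm (vec (a1, a2) (curve x y s))) t
      (((x t - a1) * Derive x t + (y t - a2) * Derive y t)
       / sqrt ((x t - a1) ^ 2 + (y t - a2) ^ 2))
    /\
    is_rotational_speed (fun s : R => vec (a1, a2) (curve x y s)) t
      (Rabs ((x t - a1) * Derive y t - Derive x t * (y t - a2))
       / ((x t - a1) ^ 2 + (y t - a2) ^ 2)).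
Proof.
  intros t ht.
  assert (shift : forall (f : R -> R) (a : R), class_C 2 f t0 t1 ->
    is_derive (fun s => f s - a) t (Derive f t)).
  { intros f a hf.
    evar_last.
    - apply @is_derive_minus.
      + apply (class_C_is_derive 2 f t0 t1); auto.
      + apply @is_derive_const.
    - unfold minus, plus, opp, zero; simpl; ring. }
  (* The vector from the point to the curve vanishes only if the curve passes through the point. *)
  assert (hne : (x t - a1, y t - a2) <> (0, 0)).
  { intros [= h1 h2].
    apply (hnot_on t ht).
    unfold curve; f_equal; lra. }
  split.
  (* By conversion, [vec (a1, a2) (curve x y s)] is the pair of the two shifted coordinates. *)
  - exact (is_derive_norm_plane (fun s => x s - a1) (fun s => y s - a2) t _ _
             (shift x a1 hx) (shift y a2 hy) hne).
  - exact (is_rotational_speed_plane (fun s => x s - a1) (fun s => y s - a2) t _ _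
             (shift x a1 hx) (shift y a2 hy) hne).
Qed.
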